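(* Let $(X,d)$ be a non-separable perfect metric space. Then $(\omega_1+1)^{\omega}$ and $(\omega_1+1)^{\omega_1}$ embed into $(CL(X),\tau_{w(d)})$, the hyperspace of nonempty closed subsets of $X$ equipped with the Wijsman topology; that is, each of these two spaces is homeomorphic to a subspace of $(CL(X),\tau_{w(d)})$.
   Context: A topological space is called perfect if it has no isolated points. $CL(X)$ denotes the family of all nonempty closed subsets of $X$. For $x\in X$ and nonempty $A\subseteq X$, $d(x,A)=\inf\{d(x,a): a\in A\}$. The Wijsman topology $\tau_{w(d)}$ on $CL(X)$ is the weakest topology such that for every $x\in X$ the distance functional $A\mapsto d(x,A)$ is continuous on $CL(X)$. The ordinal $\omega_1+1=[0,\omega_1]$ carries the order topology, and the powers $(\omega_1+1)^{\omega}$ and $(\omega_1+1)^{\omega_1}$ carry the product topology. *)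

(* Defs.v *)
From HB Require Import structures.
From mathcomp Require Import all_boot all_order all_algebra.
From mathcomp Require Import all_classical all_reals all_analysis.
From mathcomp Require Import wochoice.

Set Implicit Arguments.
Unset Strict Implicit.
Unset Printing Implicit Defensive.

Import Order.TTheory GRing.Theory Num.Theory.
Import numFieldNormedType.Exports.

Local Open Scope classical_set_scope.
Local Open Scope ring_scope.

(* The ordinal omega_1, modelled inside a fixed well-ordering of the
   (uncountable) type [set nat] as the elements whose initial segment is
   countable. The lemmas [omega1_well_order], [omega1_uncountable] and
   [omega1_countable_segment] determine the order type. *)

Definition wo_rel : rel (set nat) := sval (well_ordering_principle (set nat)).

Lemma wo_relP : well_order wo_rel.
Proof. exact: svalP (well_ordering_principle (set nat)). Qed.

Fact wo_chainT : wo_chain wo_rel predT.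
Proof. by move=> A _; exact: wo_relP. Qed.

Lemma wo_rel_total : total wo_rel.
Proof. by move=> x y; apply: (wo_chainW wo_chainT). Qed.

Lemma wo_rel_refl : reflexive wo_rel.
Proof. by move=> x; have := wo_rel_total x x; rewrite orbb. Qed.

Lemma wo_rel_anti : antisymmetric wo_rel.
Proof. by move=> x y; apply: (wo_chain_antisymmetric wo_chainT). Qed.

Lemma wo_rel_trans : transitive wo_rel.
Proof.
move=> y x z xy yz.
pose A : {pred set nat} := [pred t | [|| t == x, t == y | t == z]].
have [|m [[Am mmin] _]] := wo_relP (A := A).
  by exists x; rewrite inE eqxx.
have /mmin mx : x \in A by rewrite inE eqxx.
have /mmin my : y \in A by rewrite inE eqxx orbT.
have /mmin mz : z \in A by rewrite inE eqxx !orbT.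
move: Am; rewrite inE => /or3P[] /eqP E; move: mx my mz; rewrite E => mx my mz.
- by [].
- by have -> // : x = y by apply: wo_rel_anti; rewrite xy mx.
- by have <- : y = z by apply: wo_rel_anti; rewrite yz my.
Qed.

Definition omega1 : Type :=
  {x : set nat | `[< countable [set y | wo_rel y x] >]}.

HB.instance Definition _ := Choice.on omega1.

Fact omega1_display : Order.disp_t. Proof. exact: Order.Disp tt tt. Qed.

Definition omega1_le : rel omega1 := fun x y => wo_rel (val x) (val y).

Fact omega1_le_refl : reflexive omega1_le.
Proof. by move=> x; exact: wo_rel_refl. Qed.

Fact omega1_le_anti : antisymmetric omega1_le.
Proof. by move=> x y xy; apply: val_inj; exact: wo_rel_anti. Qed.

Fact omega1_le_trans : transitive omega1_le.
Proof. by move=> y x z; exact: wo_rel_trans. Qed.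

Fact omega1_le_total : total omega1_le.
Proof. by move=> x y; exact: wo_rel_total. Qed.

HB.instance Definition _ := Order.Le_isPOrder.Build omega1_display omega1
  omega1_le_refl omega1_le_anti omega1_le_trans.

HB.instance Definition _ :=
  Order.POrder_isTotal.Build omega1_display omega1 omega1_le_total.

Lemma omega1_well_order (A : set omega1) : A !=set0 ->
  exists2 m, A m & forall x, A x -> (m <= x)%O.
Proof.
move=> [a Aa].
have [|m [[/asboolP[x Ax xm] mmin] _]] :=
    wo_relP (A := [pred t | `[< exists2 x, A x & val x = t >]]).
  by exists (val a); apply/asboolP; exists a.
exists x => // y Ay; rewrite /Order.le/= /omega1_le xm; apply: mmin.
by apply/asboolP; exists y.
Qed.

Lemma omega1_countable_segment (x : omega1) :
  countable [set y : omega1 | (y <= x)%O].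
Proof.
have /asboolP cx := valP x.
apply/(sub_countable _ cx)/card_le_trans/card_image_le; last first.
  exact: (fun t => insubd x t).
apply: subset_card_le => y yx; exists (val y) => //.
by rewrite /insubd valK.
Qed.

Lemma omega1_uncountable : ~ countable [set: omega1].
Proof.
move=> cO.
pose B := [set t | countable [set y | wo_rel y t]].
have cB : countable B.
  apply: (sub_countable _ cO); apply: card_le_trans (card_image_le val _).
  by apply: subset_card_le => t Bt; exists (Sub t (asboolT Bt)).
have [BT|] := pselect (forall t, B t).
  have : countable [set: set nat].
    by apply: sub_countable cB; apply: subset_card_le => t _; exact: BT.
  case/countable_injP => f finj.
  pose D : set nat := [set n | exists2 S : set nat, f S = n & ~ S n].
  have [DfD|nD] := pselect (D (f D)).
    case: (DfD) => S /finj SD; apply.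
    by rewrite SD ?inE.
  by apply: (nD); exists D.
move=> /existsNP[t0 nBt0].
have [|m [[nBm mmin] _]] := wo_relP (A := [pred t | `[< ~ B t >]]).
  by exists t0; apply/asboolP.
move: nBm => /asboolP; apply; rewrite /B/=.
apply: (@sub_countable _ _ _ (m |` B)); last first.
  rewrite -bigcup2E; apply: bigcup_countable => // i _.
  by case: i => [|[|i]]; rewrite /bigcup2/= ?countable1.
apply: subset_card_le => y ym; have [By|nBy] := pselect (B y); first by right.
left; apply: wo_rel_anti; rewrite ym/=; apply: mmin; exact/asboolP.
Qed.

(* The ordinal omega_1 + 1 = [0, omega_1]: [None] is the last point omega_1. *)
Definition omega1_succ : Type := option omega1.

HB.instance Definition _ := Choice.on omega1_succ.

Definition omega1_succ_le : rel omega1_succ := fun x y =>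
  match x, y with
  | _, None => true
  | None, Some _ => false
  | Some a, Some b => (a <= b)%O
  end.

Fact omega1_succ_le_refl : reflexive omega1_succ_le.
Proof. by case=> [a|] //=; exact: lexx. Qed.

Fact omega1_succ_le_anti : antisymmetric omega1_succ_le.
Proof. by case=> [a|] [b|] //= /le_anti ->. Qed.

Fact omega1_succ_le_trans : transitive omega1_succ_le.
Proof. by case=> [b|] [a|] [c|] //=; exact: le_trans. Qed.

Fact omega1_succ_le_total : total omega1_succ_le.
Proof. by case=> [a|] [b|] //=; exact: le_total. Qed.

HB.instance Definition _ := Order.Le_isPOrder.Build omega1_display omega1_succ
  omega1_succ_le_refl omega1_succ_le_anti omega1_succ_le_trans.

HB.instance Definition _ :=
  Order.POrder_isTotal.Build omega1_display omega1_succ omega1_succ_le_total.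

Definition no_isolated_points (T : topologicalType) : Prop :=
  isolated [set: T] = set0.

Definition separable (T : topologicalType) : Prop :=
  exists2 D : set T, countable D & dense D.

Definition homeomorphic (S T : topologicalType) : Prop :=
  exists (f : S -> T) (g : T -> S),
    [/\ cancel f g, cancel g f, continuous f & continuous g].

(* [A : Type] is the subtype of [T] with the subspace topology. *)
Definition embeds_into (S T : topologicalType) : Prop :=
  exists A : set T, homeomorphic S (A : Type).

Definition CL (T : topologicalType) : Type :=
  [set A : set T | closed A /\ A !=set0].

HB.instance Definition _ (T : topologicalType) := Choice.on (CL T).

Definition set_dist (R : realType) (X : metricType R) (x : X) (A : set X) : R :=
  inf [set mdist x a | a in A].

(* [CL X] with the supremum, over all [x], of the initial topologies of the
   distance functionals: the weakest topology making all of them continuous. *)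
Definition wijsman (R : realType) (X : metricType R) : Type :=
  sup_topology (fun x : X => Topological.class
    (initial_topology (fun A : CL X => set_dist x (val A)))).

HB.instance Definition _ (R : realType) (X : metricType R) :=
  Topological.on (wijsman X).

(* Main.v *)
Require Import Defs.
From HB Require Import structures.
From mathcomp Require Import all_boot all_order all_algebra.
From mathcomp Require Import all_classical all_reals all_analysis.
From mathcomp Require Import lra.

(** Since [X] is not separable, some [eps > 0] has the property that no
    countable set comes within [eps] of every point; transfinite recursion then
    gives an [eps]-separated family indexed by [omega1 * omega1], hence also a
    family [e] indexed by [I * omega1] for [I] either [nat] or [omega1].  As
    [X] is perfect, each [e t] has a neighbour [p t <> e t] at distance less
    than [eps / 4].  The open balls centred at [e t] whose boundary sphere
    contains [p t] are then pairwise far apart, while every [p t] lies outside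
    all of them.

    For a set [U] of indices, remove from [X] the balls indexed by [U].  What
    is left is closed and contains all the points [p t], and its distance to a
    fixed point [x] depends on a single bit of [U]: it is [0] if [x] is in no
    ball, and if [x] is in the ball [t] then [p t] is nearer to [x] than any
    point of another ball, so only whether [t] belongs to [U] matters
    ([set_dist_outside_balls]).  Hence the sets of indices, topologized as the
    Cantor cube, map continuously into the Wijsman hyperspace.  The map is an
    embedding because [U] is read off from the distances to the centres [e t]:
    they vanish for [t] outside [U] and are at least the radius for [t] in [U]
    ([center_dist_ge], [center_dist_gt0]).

    On the other side, the order topology of [omega1 + 1] is generated by the
    clopen cuts [z <= b] with [b < omega1] ([near_le_Some] and
    [order_topology_cvg]), so [f |-> {(i, b) | f i <= b}] embeds the [I]-th
    power of [omega1 + 1] into that cube.  The composite of the two embeddings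
    is the one required ([power_embeds]). *)

Set Implicit Arguments.
Unset Strict Implicit.
Unset Printing Implicit Defensive.

Import Order.TTheory GRing.Theory Num.Theory.
Import numFieldNormedType.Exports.

Local Open Scope classical_set_scope.
Local Open Scope ring_scope.

(** * Separated families in a non-separable metric space *)

(** Otherwise a countable [1/n]-net exists for every [n], and the union of
    these nets is a countable dense set. *)
Lemma nonseparable_gap (R : realType) (X : metricType R) : ~ separable X ->
  exists2 eps : R, 0 < eps & forall C : set X, countable C ->
    exists x, forall c, C c -> eps <= mdist c x.
Proof.
apply: contra_notP => /forall2NP gap.
have /choice[C CP] n : exists C : set X,
    countable C /\ forall x, exists2 c, C c & mdist c x < n.+1%:R^-1.
  have [/negP|/existsNP[C /not_implyP[cC nC]]] := gap n.+1%:R^-1.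
    by rewrite invr_gt0 ltr0n.
  exists C; split=> // x; apply: contrapT => /forall2NP far; apply: nC.
  by exists x => c Cc; have [//|/negP] := far c; rewrite -leNgt.
exists (\bigcup_n C n).
  by apply: bigcup_countable => // n _; have [] := CP n.
move=> O [x Ox]; rewrite openE => /(_ _ Ox).
rewrite /interior -filter_from_ballE => -[r r0 xrO].
have [n nr] : exists n, n.+1%:R^-1 < r.
  have [n _ /(_ _ (leqnn _))] := near_infty_natSinv_lt (PosNum r0).
  by exists n.
have [_ /(_ x)[c Cc cx]] := CP n.
exists c; split; last by exists n.
by apply: xrO; rewrite ballEmdist/= metric_sym (lt_trans cx).
Qed.

(** Transfinite recursion along [lt]: the countably many points chosen before
    stage [t] leave room for one more at distance at least [eps]. *)
Lemma separated_family (R : realType) (X : metricType R) (eps : R)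
    (gap : forall C : set X, countable C ->
      exists x, forall c, C c -> eps <= mdist c x)
    (T : Type) (lt : T -> T -> Prop) (wf_lt : well_founded lt)
    (lt_total : forall s t, s <> t -> lt s t \/ lt t s)
    (lt_countable : forall t, countable [set s | lt s t]) :
  exists e : T -> X, forall s t, s <> t -> eps <= mdist (e s) (e t).
Proof.
have /choice[g gP] (C : set X) : exists x, countable C ->
    forall c, C c -> eps <= mdist c x.
  have [cC|nC] := pselect (countable C).
    by have [x xP] := gap _ cC; exists x.
  by have [x _] := gap _ (@countable0 X); exists x.
pose F t (rec : forall s, lt s t -> X) :=
  g [set x | exists s (st : lt s t), rec s st = x].
pose e := Fix wf_lt (fun=> X) F.
have eE t : e t = g [set e s | s in [set s | lt s t]].
  rewrite /e Fix_eq => [|u f h fh].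
    congr g; apply/seteqP; split=> [x [s [st <-]]|x [s st <-]].
      by exists s.
    by exists s, st.
  congr g; apply/seteqP; split=> x [s [st <-]]; exists s, st;
    by rewrite ?fh // -fh.
have far s t : lt s t -> eps <= mdist (e s) (e t).
  move=> st; rewrite (eE t); apply: gP; last by exists s.
  exact: sub_countable (card_image_le _ _) (lt_countable t).
exists e => s t /lt_total[/far//|/far].
by rewrite metric_sym.
Qed.

Lemma omega1_lt_wf : well_founded (fun x y : omega1 => (x < y)%O).
Proof.
move=> x; apply: contrapT => nx.
have [|m nm mmin] := @omega1_well_order
    [set x | ~ Acc (fun x y : omega1 => (x < y)%O) x]; first by exists x.
apply: nm; constructor => y ym; apply: contrapT => /mmin.
by rewrite leNgt ym.
Qed.

(** The square of [omega1] is well-ordered in type [omega1]: compare first the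
    larger coordinates, then, among the countably many pairs that share a
    larger coordinate, their ranks in an enumeration.  All initial segments
    are countable, so the recursion of [separated_family] applies. *)
Lemma omega1_square_separated (R : realType) (X : metricType R) (eps : R)
    (gap : forall C : set X, countable C ->
      exists x, forall c, C c -> eps <= mdist c x) :
  exists e : omega1 * omega1 -> X,
    forall s t, s <> t -> eps <= mdist (e s) (e t).
Proof.
pose m (p : omega1 * omega1) := Order.max p.1 p.2.
have csq (g : omega1) : countable [set p | (m p <= g)%O].
  apply: (@sub_countable _ _ _ ([set y | (y <= g)%O] `*` [set y | (y <= g)%O])).
    by apply: subset_card_le => p /=; rewrite /m ge_max => /andP.
  by apply: countableX; exact: omega1_countable_segment.
have /choice[idx idxP] (g : omega1) : exists f : omega1 * omega1 -> nat,
    {in [set p | (m p <= g)%O] &, injective f}.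
  exact/countable_injP.
pose k p := idx (m p) p.
pose lt p q := (m p < m q)%O \/ m p = m q /\ (k p < k q)%N.
have lt_wf : well_founded lt.
  suff acc g n p : m p = g -> k p = n -> Acc lt p by move=> p; exact: acc.
  elim/(well_founded_induction omega1_lt_wf): g n p => g IHg.
  elim/ltn_ind => n IHn p mp kp; constructor=> q [qp|[qp kqp]].
    by apply: (IHg (m q)) => //; rewrite -mp.
  by apply: (IHn (k q)) => //; [rewrite -kp | rewrite qp].
apply: (separated_family gap lt_wf) => [p q pq|q].
  have [mpq|mqp|mpq] := ltgtP (m p) (m q); [by left; left|by right; left|].
  have [kpq|kqp|kpq] := ltngtP (k p) (k q).
  - by left; right.
  - by right; right.
  - case: pq; apply: (idxP (m p)); rewrite ?inE//= ?mpq//.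
    by rewrite -[in LHS]mpq.
apply: sub_countable (csq (m q)); apply: subset_card_le => p.
by case=> [/ltW//|[/= ->]].
Qed.

(** * Distance functionals and the Wijsman topology *)

Lemma set_dist_le (R : realType) (X : metricType R) (x a : X) (A : set X) :
  A a -> set_dist x A <= mdist x a.
Proof.
move=> Aa; apply: ge_inf; last by exists a.
by exists 0 => _ [b _ <-]; exact: mdist_ge0.
Qed.

Lemma le_set_dist (R : realType) (X : metricType R) (x : X) (A : set X)
    (r : R) :
  A !=set0 -> (forall a, A a -> r <= mdist x a) -> r <= set_dist x A.
Proof.
move=> [a Aa] rA; apply: lb_le_inf; first by exists (mdist x a), a.
by move=> _ [b Ab <-]; exact: rA.
Qed.

Lemma set_dist_mono (R : realType) (X : metricType R) (x : X) (A B : set X) :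
    A !=set0 -> (forall a, A a -> exists2 b, B b & mdist x b <= mdist x a) ->
  set_dist x B <= set_dist x A.
Proof.
move=> A0 AB; apply: le_set_dist => // a /AB[b Bb]; apply: le_trans.
exact: set_dist_le.
Qed.

Lemma set_dist_continuous (R : realType) (X : metricType R) (x : X) :
  continuous (fun A : wijsman X => set_dist x (val A)).
Proof.
move=> A.
have cA :=
  (@cvg_sup (CL X) X _ (nbhs A) A (nbhs_filter A)).1 (@cvg_id _ _) x.
apply: cvg_trans (cvg_app _ cA) _.
exact: (@initial_continuous (CL X) R (fun A => set_dist x (val A))).
Qed.

(** The values of [f] need not be locally constant: only each distance
    functional taken separately is, on a neighbourhood depending on [x]. *)
Lemma wijsman_locally_constant_continuous (R : realType) (X : metricType R)
    (S : topologicalType) (f : S -> wijsman X) :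
    (forall x s, \forall s' \near s,
      set_dist x (val (f s')) = set_dist x (val (f s))) ->
  continuous f.
Proof.
move=> cf s; apply/cvg_sup => x.
apply: (@continuous_comp_initial (CL X) S R (fun A => set_dist x (val A)) f).
move=> {}s; apply: cvg_near_cst; exact: cf.
Qed.

(** Given continuity, the last hypothesis says that [S] carries the initial
    topology of [f]. *)
Lemma embeds_into_initial (S T : topologicalType) (f : S -> T) :
    injective f -> continuous f ->
    (forall s, filter_from (nbhs (f s)) (fun V => f @^-1` V) --> s) ->
  embeds_into S T.
Proof.
move=> finj fcont finit; exists (range f).
pose h s : range f := SigSub (mem_set (imageT f s)).
have /choice[g gP] (a : range f) : exists s, f s = val a.
  by have /set_mem[s _ <-] := valP a; exists s.
exists h, g; split.
- by move=> s; apply: finj; rewrite gP.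
- by move=> a; apply: val_inj; rewrite /= gP.
- exact: (@continuous_comp_initial _ _ _ set_val h).
- move=> a U /finit[V Va VU].
  apply: (@filterS _ _ _ (val @^-1` V)).
    by move=> b Vb; apply: VU; rewrite /= gP.
  apply: (@initial_continuous _ _ (set_val : range f -> T)).
  by rewrite gP in Va.
Qed.

(** * The order topology of omega1 + 1 *)

(** Cuts at countable ordinals suffice to test convergence to [y]: a ray
    [z < b] containing [y] forces [y] to be countable, and then contains the
    cut [z <= y]. *)
Lemma order_topology_cvg (G : set_system (order_topology omega1_succ))
    (y : order_topology omega1_succ) : Filter G ->
    (forall b : omega1,
      G [set z : order_topology omega1_succ |
        (z <= Some b)%O = (y <= Some b)%O]) ->
  G --> y.
Proof.
move=> FG Gcut.
have Gr (a : order_topology omega1_succ) : (a < y)%O ->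
    G [set z : order_topology omega1_succ | (a < z)%O].
  case: a => [a|]; last by case: (y).
  move=> ay; apply: filterS (Gcut a) => z /=.
  by rewrite [(y <= _)%O]leNgt ay leNgt => /negbFE.
have Gl (b : order_topology omega1_succ) : (y < b)%O ->
    G [set z : order_topology omega1_succ | (z < b)%O].
  case: y Gcut {Gr} => [y|]; last by case: b.
  move=> Gcut yb; apply: filterS (Gcut y) => z /=; rewrite lexx => zy.
  exact: le_lt_trans zy yb.
move=> U; rewrite order_nbhs_itv => -[i [oi yi] iU].
apply: (filterS iU).
case: i oi yi {iU} => [[[] a|[]] [[] b|[]]] //= _; rewrite in_itv /=.
- move=> /andP[ay yb]; apply: filterS (filterI (Gr _ ay) (Gl _ yb)) => z.
  by move=> [az zb]; rewrite /= in_itv /= az.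
- rewrite andbT => /Gr; apply: filterS => z az.
  by rewrite /= in_itv /= az.
- move=> /Gl; apply: filterS => z zb.
  by rewrite /= in_itv.
- by move=> _; apply: filterS filterT => z _; rewrite /= in_itv.
Qed.

Lemma le_Some (a b : omega1) :
  ((Some a : omega1_succ) <= Some b)%O = (a <= b)%O.
Proof. by []. Qed.

(** The successor [c] is what makes the cut [z <= Some b] open. *)
Lemma omega1_succ_successor (b : omega1) :
  exists c : omega1_succ, forall z : omega1_succ, (z <= Some b)%O = (z < c)%O.
Proof.
have [[a ba]|nb] := pselect (exists a : omega1, (b < a)%O).
  have [|c bc cmin] := @omega1_well_order [set a | (b < a)%O].
    by exists a.
  exists (Some c) => -[z|] //.
  apply/idP/idP => [zb|]; first exact: (le_lt_trans zb).
  rewrite ltNge; apply: contraNT; rewrite -ltNge => bz.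
  by apply: (cmin z); move: bz; rewrite /= !ltNge le_Some.
exists None => -[z|] //.
by apply: contrapT => /negP; rewrite le_Some -ltNge => bz; apply: nb; exists z.
Qed.

Lemma near_le_Some (y : order_topology omega1_succ) (b : omega1) :
  nbhs y [set z : order_topology omega1_succ |
    (z <= Some b)%O = (y <= Some b)%O].
Proof.
have [yb|] := leP y (Some b : order_topology omega1_succ).
  have [c bc] := omega1_succ_successor b.
  have : nbhs y [set` `]-oo, (c : order_topology omega1_succ)[].
    apply: open_nbhs_nbhs; split; first exact: lray_open.
    by rewrite /= in_itv/= -bc.
  by apply: filterS => z; rewrite /= in_itv /= -bc.
move=> by_.
have : nbhs y [set` `](Some b : order_topology omega1_succ), +oo[].
  apply: open_nbhs_nbhs; split; first exact: rray_open.
  by rewrite /= in_itv/= by_.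
by apply: filterS => z; rewrite /= in_itv /= andbT => /lt_geF.
Qed.

(** * Removing sparse balls *)

Lemma perfect_near (R : realType) (X : metricType R) (x : X) (r : R) :
  no_isolated_points X -> 0 < r -> exists2 p, x <> p & mdist x p < r.
Proof.
move=> perfX r0; apply: contrapT => /forall2NP nop.
suff : isolated [set: X] x by rewrite perfX.
split; first by rewrite inE.
exists (ball x r); first exact: nbhsx_ballx.
rewrite setIT; apply/seteqP; split=> [y|y ->]; last exact: ballxx.
rewrite ballEmdist /= => xy; have [|//] := nop y.
by move=> /contrapT.
Qed.

(** The complement of the union, over [t] in [U], of the open balls centred at
    [e t] whose boundary sphere contains [p t]. *)
Definition outside_balls (R : realType) (X : metricType R) (T : Type)
    (e p : T -> X) (U : set T) : set X :=
  [set x | forall t, U t -> mdist (e t) (p t) <= mdist (e t) x].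

Lemma outside_balls_closed (R : realType) (X : metricType R) (T : Type)
  (e p : T -> X) (U : set T) : closed (outside_balls e p U).
Proof.
move=> x clx t Ut; rewrite leNgt; apply/negP => tx.
have r0 : 0 < mdist (e t) (p t) - mdist (e t) x by rewrite subr_gt0.
have [y [Ay]] := clx _ (nbhsx_ballx x _ r0).
rewrite ballEmdist /= => xy.
have := Ay t Ut; have := metric_triangle (e t) x y; lra.
Qed.

Section sparse_balls.
Context (R : realType) (X : metricType R) (T : Type) (e p : T -> X) (eps : R).
Hypothesis sep : forall s t, s <> t -> eps <= mdist (e s) (e t).
Hypothesis epN : forall t, e t <> p t.
Hypothesis ep_near : forall t, mdist (e t) (p t) < eps / 4.
Local Notation A := (outside_balls e p).

(** The centres are [eps] apart and the radii are below [eps / 4], so no ball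
    reaches the bounding sphere of another one.  The points [p t] keep the sets
    [A U] nonempty and replace the points of removed balls. *)
Lemma outside_balls_boundary U t : A U (p t).
Proof.
move=> s _; have [->//|st] := pselect (s = t).
have := metric_triangle (e s) (p t) (e t); rewrite (metric_sym (p t)).
have := sep st; have := ep_near s; have := ep_near t.
have := mdist_ge0 (e s) (p s); lra.
Qed.

Lemma outside_balls_center U t : ~ U t -> A U (e t).
Proof.
move=> nUt s Us; have st : s <> t by move=> st; apply: nUt; rewrite -st.
have := sep st; have := ep_near s; have := mdist_ge0 (e s) (p s); lra.
Qed.

Lemma ball_radius_gt0 t : 0 < mdist (e t) (p t).
Proof. by rewrite mdist_gt0; apply/eqP. Qed.

Lemma center_dist_ge U t : U t -> mdist (e t) (p t) <= set_dist (e t) (A U).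
Proof.
move=> Ut; apply: le_set_dist; last by move=> y; exact.
by exists (p t); exact: outside_balls_boundary.
Qed.

(** This makes [U] recoverable from [A U], through conditions that are open in
    the Wijsman topology. *)
Lemma center_dist_gt0 U t : 0 < set_dist (e t) (A U) <-> U t.
Proof.
split=> [d0|Ut].
  apply: contrapT => /outside_balls_center/(set_dist_le (e t)).
  by rewrite mdistxx leNgt d0.
exact: lt_le_trans (ball_radius_gt0 t) (center_dist_ge Ut).
Qed.

Lemma outside_balls_inj U V : A U = A V -> U = V.
Proof.
by move=> UV; apply/seteqP; split=> t /center_dist_gt0 d0;
  apply/center_dist_gt0; [rewrite -UV|rewrite UV].
Qed.

(** The index [t] is that of the ball containing [x], or the arbitrary [t0]
    when [x] is in no ball and the distance is always [0]. *)
Lemma set_dist_outside_balls x (t0 : T) : exists t, forall U V,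
  (U t <-> V t) -> set_dist x (A U) = set_dist x (A V).
Proof.
have A0 U : A U !=set0 by exists (p t0); exact: outside_balls_boundary.
have [[t tx]|out] := pselect (exists t, mdist (e t) x < mdist (e t) (p t)).
  exists t.
  suff le U V : (V t -> U t) -> set_dist x (A V) <= set_dist x (A U).
    by move=> U V UV; apply/le_anti/andP; split; apply: le => /UV.
  move=> VU; apply: set_dist_mono => // a Ua.
  (* A point [a] available for [U] but not for [V] lies in a ball [s] <> [t]
     removed by [V].  Then either the ball [t] is kept by [V], and [x] itself is
     available, or [p t] is available and closer to [x] than [a]. *)
  have [Va|/existsNP[s /not_implyP[Vs /negP]]] := pselect (A V a).
    by exists a.
  rewrite -ltNge => sa.
  have [Vt|nVt] := pselect (V t); last first.
    exists x; last by rewrite mdistxx mdist_ge0.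
    move=> u Vu; have ut : u <> t by move=> ut; apply: nVt; rewrite -ut.
    have := metric_triangle (e u) x (e t); rewrite (metric_sym x).
    have := sep ut; have := ep_near u; have := ep_near t.
    have := mdist_ge0 (e t) x; lra.
  have st : s <> t by move=> st; have := Ua t (VU Vt); rewrite -st leNgt sa.
  exists (p t); first exact: outside_balls_boundary.
  have := metric_triangle x (e t) (p t); rewrite (metric_sym x (e t)).
  have := metric_triangle (e s) a (e t).
  have := metric_triangle a x (e t).
  rewrite (metric_sym a x) (metric_sym x (e t)).
  have := sep st; have := ep_near s; have := ep_near t.
  have := mdist_ge0 (e t) x; lra.
have Ax U : A U x.
  by move=> t _; rewrite leNgt; apply/negP => tx; apply: out; exists t.
suff d0 U : set_dist x (A U) = 0 by exists t0 => U V _; rewrite !d0.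
apply/le_anti/andP; split; first by rewrite -(mdistxx x) set_dist_le.
by apply: le_set_dist => // a _; exact: mdist_ge0.
Qed.

Definition outside_ballsCL (t0 : T) (U : set T) : wijsman X :=
  SigSub (mem_set (conj (@outside_balls_closed R X T e p U)
    (ex_intro _ (p t0) (@outside_balls_boundary U t0)))).

End sparse_balls.

(** * Embedding the powers of omega1 + 1 *)

(** The closed set attached to [f] misses the ball [(i, b)] exactly when
    [f i <= b]. *)
Lemma power_embeds (R : realType) (X : metricType R) (I : choiceType)
    (e p : I * omega1 -> X) (eps : R) (t0 : I * omega1)
    (sep : forall s t, s <> t -> eps <= mdist (e s) (e t))
    (epN : forall t, e t <> p t)
    (ep_near : forall t, mdist (e t) (p t) < eps / 4) :
  embeds_into {ptws I -> order_topology omega1_succ} (wijsman X).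
Proof.
pose U (f : {ptws I -> order_topology omega1_succ}) : set (I * omega1) :=
  [set t | (f t.1 <= Some t.2)%O].
have nearU f t : nbhs f [set g | U g t <-> U f t].
  have := @proj_continuous I (fun=> order_topology omega1_succ) t.1 f _
    (near_le_Some (f t.1) t.2).
  apply: (@filterS _ (nbhs f)) => g /= gf; rewrite /U /=.
  by rewrite -gf.
pose F f := outside_ballsCL sep ep_near t0 (U f).
apply: (@embeds_into_initial _ _ F) => [f g|f|f].
- move=> /(congr1 val) /(outside_balls_inj sep epN ep_near) fg.
  have le_fg f' g' i : U f' = U g' -> (f' i <= g' i)%O.
    move=> fg'; case gi: (g' i) => [b|]; last by case: (f' i).
    have : U g' (i, b) by rewrite /U /= gi.
    by rewrite -fg'.
  by apply/funext => i; apply/le_anti; rewrite !le_fg.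
- move: f; apply: wijsman_locally_constant_continuous => x f.
  have [t tP] := set_dist_outside_balls sep ep_near x t0.
  by apply: (@filterS _ (nbhs f)) (nearU f t) => g; exact: tP.
- have FF : Filter (filter_from (nbhs (F f)) (fun V => F @^-1` V)).
    apply: filter_from_filter; first by exists setT; exact: filterT.
    by move=> V W VF WF; exists (V `&` W) => //; exact: filterI.
  apply/cvg_sup => i W [_ [[B oB <-] Bf BW]].
  apply: (filterS BW).
  (* The cut of [f i] at [b] is determined near [F f] by the distance to the
     centre [e (i, b)]: positive below the cut, below the radius above it. *)
  suff : (fun g : {ptws I -> order_topology omega1_succ} => g i) @
      filter_from (nbhs (F f)) (fun V => F @^-1` V) --> f i.
    by apply; exact: open_nbhs_nbhs.
  apply: order_topology_cvg => b.
  have dc := @set_dist_continuous R X (e (i, b)) (F f).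
  have dU g : 0 < set_dist (e (i, b)) (val (F g)) <-> U g (i, b).
    exact (center_dist_gt0 sep epN ep_near (U g) (i, b)).
  have [fb|fb] := boolP (f i <= Some b)%O.
    exists [set C | 0 < set_dist (e (i, b)) (val C)].
      by apply: (dc [set r | 0 < r]); apply: lt_nbhsr; exact/dU.
    by move=> g /= /dU.
  exists [set C | set_dist (e (i, b)) (val C) < mdist (e (i, b)) (p (i, b))].
    apply: (dc [set r | r < _]); apply: lt_nbhsl.
    apply: le_lt_trans (ball_radius_gt0 epN (i, b)).
    by rewrite leNgt; apply/negP => /dU; apply/negP.
  move=> g /= gd; apply/negP => gb.
  have := @center_dist_ge _ _ _ _ _ _ sep ep_near (U g) (i, b) gb.
  by rewrite leNgt gd.
Qed.

Theorem theorem3p3 (R : realType) (X : metricType R)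
    (nonsepX : ~ separable X) (perfectX : no_isolated_points X) :
  embeds_into {ptws nat -> order_topology omega1_succ} (wijsman X) /\
  embeds_into {ptws omega1 -> order_topology omega1_succ} (wijsman X).
Proof.
have [eps eps0 gap] := nonseparable_gap nonsepX.
have [e sep] := omega1_square_separated gap.
have [b0 _] : exists b : omega1, True.
  have [|b0 _] := @infinite_setN0 _ [set: omega1]; last by exists b0.
  by move/finite_set_countable; exact: omega1_uncountable.
have embed (I : choiceType) (j : I -> omega1) (i0 : I) : injective j ->
    embeds_into {ptws I -> order_topology omega1_succ} (wijsman X).
  move=> jinj; pose e' (t : I * omega1) := e (j t.1, t.2).
  have /choice[p pP] t : exists p, e' t <> p /\ mdist (e' t) p < eps / 4.
    have [|p] := @perfect_near _ _ (e' t) (eps / 4) perfectX; last by exists p.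
    by rewrite divr_gt0.
  apply: (@power_embeds _ _ _ e' p eps (i0, b0)).
  - move=> [i b] [i' b'] ne; apply: sep => -[/jinj ii bb].
    by apply: ne; rewrite ii bb.
  - by move=> t; have [] := pP t.
  - by move=> t; have [] := pP t.
pose omega1_pointed : pointedType := HB.pack omega1 (isPointed.Build omega1 b0).
have [j] : exists j : nat -> omega1, injective j.
  have /infiniteP/(@pcard_injP _ omega1_pointed)[j jinj] :
      infinite_set [set: omega1].
    by move/finite_set_countable; exact: omega1_uncountable.
  by exists j => m n jmn; apply: jinj; rewrite ?inE.
by split; [exact: (embed _ j 0%N)|exact: (embed _ id b0)].
Qed.
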